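(* Let $X$ be a finite alphabet with at least two letters, and let $\mathsf A$ be a finite automaton over $X$ with a subautomaton $\mathsf B$ such that different cycles in $\mathsf A\setminus\mathsf B$ are disjoint and the group generated by $\mathsf B$ is contracting. Let $G$ be the automaton group generated by $\mathsf A$, and let $m$ be the maximal number of different cycles in $\mathsf A\setminus\mathsf B$ connected by a directed path. There exists a constant $C$ such that every orbital Schreier graph $\Gamma_w(G)$, $w\in X^{\omega}$, has subexponential growth bounded above by $|X|^{C(\log n)^{m+1}}$.
   Context: Automata. $X^{*}$ is the set of finite words over $X$ (including the empty word) and $X^{\omega}$ is the set of right-infinite sequences over $X$. An (invertible) automaton over $X$ consists of a set of states $S$, a transition function $\lambda:S\times X\to S$ and an output function $\pi:S\times X\to X$ such that $\pi(s,\cdot)$ is a permutation of $X$ for every $s\in S$. It is viewed as a directed labeled graph with vertex set $S$ and, for every $s\in S$ and $x\in X$, an arrow $s\to\lambda(s,x)$ labeled $x|\pi(s,x)$ (different letters give different arrows). Each state $s$ acts on $X^{*}\cup X^{\omega}$: $s(xv)=\pi(s,x)\,\lambda(s,x)(v)$. This action is invertible. All automata are assumed minimized: different states act differently on $X^{\omega}$, and states are identified with the corresponding transformations of $X^{\omega}$. A subautomaton of $\mathsf A$ is a subset $\mathsf B$ of its states (with the induced arrows) closed under transitions: $\lambda(s,x)\in\mathsf B$ for all $s\in\mathsf B$, $x\in X$. The automaton group generated by an automaton is the group of transformations generated by all its states. Cycles. A cycle means a simple directed cycle (loops included). Cycles in $\mathsf A\setminus\mathsf B$ are cycles all of whose vertices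 are states of $\mathsf A$ not in $\mathsf B$; disjoint means sharing no vertex; cycles are connected by a directed path if one directed path meets all of them. Restrictions and contracting groups. For an element $g$ of an automaton group and $v\in X^*$, the restriction $g|_v$ is the element of the group determined by $g(vw)=g(v)\,g|_v(w)$ for all $w\in X^{*}\cup X^{\omega}$. An automaton group $H$ is contracting if there is a finite subset $\mathcal N\subset H$ such that for every $g\in H$ there is $n\in\mathbb N$ with $g|_v\in\mathcal N$ for all $v\in X^*$ with $|v|\ge n$. Schreier graphs. For a finite generating set $S$ of $G$, $\Gamma_w(G)=\Gamma_w(G,S)$ is the graph with vertex set the orbit $G(w)$, in which $u,v$ are adjacent iff $s(v)=u$ for some $s\in S\cup S^{-1}$. Its growth does not depend on the choice of $S$. Growth. The growth function $\gamma_v(n)$ of a connected locally finite graph with respect to a vertex $v$ is the number of vertices in the closed ball of radius $n$ centered at $v$. A function $f$ has growth not greater than (is bounded above, in the sense of growth, by) $g$, written $f\prec g$, if there is a constant $c>0$ with $f(n)\le g(cn)$ for all $n\in\mathbb N$; $f\sim g$ (equivalent) if $f\prec g$ and $g\prec f$. The growth functions with respect to different vertices are equivalent, so one speaks of the growth of the graph. A graph has subexponential growth if its growth function has growth not greater than $a^n$ ($a>1$) and is not equivalent to it. Logarithms are to base $2$, with the convention $\log 0=\log 1=1$. *)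

(* Defs.v *)
From HB Require Import structures.
From mathcomp Require Import all_boot all_order all_algebra perm finmap.
From mathcomp Require Import all_classical all_reals all_analysis.

Set Implicit Arguments.
Unset Strict Implicit.
Unset Printing Implicit Defensive.
Import Order.TTheory GRing.Theory Num.Theory.

Local Open Scope classical_set_scope.
Local Open Scope ring_scope.

(* The sequences in X^omega are the functions nat -> X; transformations of
   X^omega are compared by Leibniz equality, which is pointwise equality by
   functional extensionality. *)

Section Words.
Variable X : Type.

(* The last argument of nth is reached exactly when n >= size v. *)
Definition wcat (v : seq X) (w : nat -> X) : nat -> X :=
  fun n => nth (w (n - size v)%N) v n.

(* h is the restriction g|_v; the word u is g(v). *)
Definition is_restriction (g : (nat -> X) -> (nat -> X)) (v : seq X)
    (h : (nat -> X) -> (nat -> X)) : Prop :=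
  exists u : seq X, size u = size v /\ forall w, g (wcat v w) = wcat u (h w).

Definition contracting (H : set ((nat -> X) -> (nat -> X))) : Prop :=
  exists N : set ((nat -> X) -> (nat -> X)),
    [/\ finite_set N, N `<=` H &
      forall g, H g -> exists n : nat, forall v : seq X, (n <= size v)%N ->
        exists2 h, N h & is_restriction g v h].

End Words.

Section Transformations.
Variable T : Type.

Definition inverse_of (g h : T -> T) : Prop := cancel g h /\ cancel h g.

(* The group of transformations generated by a set of bijections of T. *)
Inductive generated_group (S : set (T -> T)) : set (T -> T) :=
| generated_id : generated_group S idfun
| generated_gen g of S g : generated_group S g
| generated_comp g h of generated_group S g & generated_group S h :
    generated_group S (g \o h)
| generated_inv g h of generated_group S g & inverse_of g h :
    generated_group S h.

Definition orbit_of (G : set (T -> T)) (w : T) : set T :=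
  [set g w | g in G].

Definition with_inverses (S : set (T -> T)) : set (T -> T) :=
  S `|` [set h | exists2 g, S g & inverse_of g h].

End Transformations.

Record graph (T : Type) := Graph {
  vertices : set T;
  adjacent : T -> T -> Prop }.

Definition schreier_graph (T : Type) (G S : set (T -> T)) (w : T) : graph T :=
  Graph (orbit_of G w)
        (fun u v => exists2 s, with_inverses S s & s v = u).

Fixpoint graph_ball (T : Type) (Gamma : graph T) (v : T) (n : nat) : set T :=
  if n is k.+1 then
    graph_ball Gamma v k `|`
    [set u | vertices Gamma u /\
             exists2 t, graph_ball Gamma v k t & adjacent Gamma u t]
  else [set v].

(* fset_set sends an infinite set to the empty one; the balls of a locally
   finite graph are finite. *)
Definition growth (T : choiceType) (Gamma : graph T) (v : T) (n : nat) : nat :=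
  #|` fset_set (graph_ball Gamma v n)|.

Section Growth.
Variable R : realType.

(* Growth functions are defined on nat, so the constant c is an integer. *)
Definition growth_le (f g : nat -> R) : Prop :=
  exists2 c : nat, (0 < c)%N & forall n, f n <= g (c * n)%N.

Definition growth_equiv (f g : nat -> R) : Prop :=
  growth_le f g /\ growth_le g f.

(* The exponential functions with bases a > 1 are all equivalent. *)
Definition subexponential (f : nat -> R) : Prop :=
  forall a : R, 1 < a ->
    growth_le f (fun n => a ^+ n) /\ ~ growth_equiv f (fun n => a ^+ n).

Definition log2 (n : nat) : R :=
  if (n <= 1)%N then 1 else ln n%:R / ln 2.

End Growth.

Record automaton (X : finType) := Automaton {
  state :> finType;
  transition : state -> X -> state;
  output : state -> {perm X} }.

Arguments transition {X} a s x.
Arguments output {X} a s.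

Section Automata.
Variables (X : finType) (A : automaton X).

Fixpoint state_act (s : A) (w : nat -> X) (n : nat) : X :=
  if n is k.+1 then
    state_act (transition A s (w 0%N)) (fun i => w i.+1) k
  else output A s (w 0%N).

Definition minimized : Prop := injective state_act.

Definition subautomaton (B : {set A}) : Prop :=
  forall s x, s \in B -> transition A s x \in B.

Definition automaton_group (B : {set A}) : set ((nat -> X) -> (nat -> X)) :=
  generated_group [set state_act s | s in [set` B]].

(* The arrow labelled x | output s x leaving s is the pair (s, x). *)
Definition simple_closed_path (c : seq (A * X)) : bool :=
  [&& c != [::], uniq [seq a.1 | a <- c] &
      cycle (fun a b => transition A a.1 a.2 == b.1) c].

(* A cycle is its set of arrows, so that cyclic rotations of a closed path
   give the same cycle, while parallel arrows give different cycles. *)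
Definition cycle_outside (B : {set A}) (E : {set A * X}) : Prop :=
  exists c : seq (A * X),
    [/\ simple_closed_path c, all (fun a => a.1 \notin B) c
      & E = [set:: c]%SET].

Definition cycle_vertices (E : {set A * X}) : {set A} :=
  [set a.1 | a in E]%SET.

Definition disjoint_cycles (B : {set A}) : Prop :=
  forall E F : {set A * X}, cycle_outside B E -> cycle_outside B F -> E <> F ->
    [disjoint cycle_vertices E & cycle_vertices F]%bool.

(* The directed path may repeat states and may pass through B. *)
Definition connected_by_path (K : {set {set A * X}}) : Prop :=
  exists (s : A) (p : seq A),
    path (fun t t' => [exists x, transition A t x == t']) s p /\
    forall E, E \in K -> exists2 t, t \in s :: p & t \in cycle_vertices E.

Definition max_connected_cycles (B : {set A}) : nat :=
  (\max_(K : {set {set A * X}} |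
      `[< (forall E, E \in K -> cycle_outside B E) /\ connected_by_path K >])
    #|K|)%N.

End Automata.

(* Main.v *)
(* A word of n states (or inverses) is restricted along longer and longer
   prefixes of its input.  The level of a state is the number of cycles outside
   B that a path from it can meet.  After |A| steps a state of top level j lies
   on a cycle and keeps its level only along the unique sequence following that
   cycle.  If the word between two consecutive states of level j has lower level
   and maps the output of one cycle to the input of the next, the two move
   together and form one block.  Otherwise, by induction on j, after some number
   k of steps at least one of them has dropped to a lower level.  The number of
   blocks is therefore halved every k steps, and log n rounds leave at most one,
   so each level costs a factor log n in depth, starting from O(log n) for the
   contracting group of B.  A word with a single block moves a sequence to few
   places: up to the first letter at which the input leaves the cycle the output
   is prescribed, and after it only lower levels act. *)

Require Import Defs.
From HB Require Import structures.
From mathcomp Require Import all_boot all_order all_algebra perm finmap.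
From mathcomp Require Import all_classical all_reals all_analysis.
From mathcomp Require Import zify ring lra.

Set Implicit Arguments.
Unset Strict Implicit.
Unset Printing Implicit Defensive.
Import Order.TTheory GRing.Theory Num.Theory.

Local Open Scope classical_set_scope.
Local Open Scope ring_scope.

(** * Restrictions of words *)

Section Sequences.
Variable X : Type.
Local Open Scope nat_scope.
Implicit Types (u w : nat -> X) (k l : nat).

Definition shift k w : nat -> X := fun i => w (k + i).

Definition agree k u w := forall i, i < k -> u i = w i.

Lemma shiftD k l w : shift l (shift k w) = shift (k + l) w.
Proof. by apply/funext => i; rewrite /shift addnA. Qed.

Lemma agree_sym k u w : agree k u w -> agree k w u.
Proof. by move=> h i /h. Qed.

Lemma agree_trans k u v w : agree k u v -> agree k v w -> agree k u w.
Proof. by move=> h h' i ik; rewrite h // h'. Qed.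

Lemma agree_le k l u w : k <= l -> agree l u w -> agree k u w.
Proof. by move=> kl h i ik; apply/h/(leq_trans ik). Qed.

Lemma agree_all u w : (forall k, agree k u w) -> u = w.
Proof. by move=> h; apply/funext => i; apply: (h i.+1). Qed.

Lemma agree_shift k l u w :
  agree (k + l) u w -> agree l (shift k u) (shift k w).
Proof. by move=> h i il; apply: h; rewrite ltn_add2l. Qed.

Lemma agree_add k l u w : agree k u w -> agree l (shift k u) (shift k w) ->
  agree (k + l) u w.
Proof.
move=> h h' i; case: (ltnP i k) => [/h //|ki] ikl.
have := h' (i - k); rewrite /shift subnKC //; apply.
by rewrite ltn_subLR.
Qed.

Lemma agree_shift_eq k u w :
  agree k u w -> shift k u = shift k w -> u = w.
Proof.
move=> h e; apply/agree_all => l; apply: (@agree_le _ (k + l)).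
  exact: leq_addl.
by apply: agree_add => //; rewrite e.
Qed.

Lemma shift_wcat v w : shift (size v) (wcat v w) = w.
Proof.
apply/funext => i; rewrite /shift /wcat addnC addnK nth_default //.
exact: leq_addl.
Qed.

Lemma shift_wcat_mkseq k u w : shift k (wcat (mkseq u k) w) = w.
Proof. by rewrite -{2}(shift_wcat (mkseq u k) w) size_mkseq. Qed.

Lemma agree_wcat k u w : agree k (wcat (mkseq u k) w) u.
Proof.
move=> i ik; rewrite /wcat (set_nth_default (u i)) ?size_mkseq //.
by rewrite nth_mkseq.
Qed.

Lemma wcat_mkseq k w : wcat (mkseq w k) (shift k w) = w.
Proof.
apply: (@agree_shift_eq k); first exact: agree_wcat.
by rewrite shift_wcat_mkseq.
Qed.

Lemma agreeVdiff k u w :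
  agree k u w \/ exists2 l, l < k & agree l u w /\ u l <> w l.
Proof.
elim: k => [|k [ih|[l lk ih]]]; first by left.
  have [e|ne] := pselect (u k = w k).
    by left=> i; rewrite ltnS leq_eqVlt => /orP[/eqP->|/ih].
  by right; exists k.
by right; exists l => //; apply: ltnW.
Qed.

End Sequences.

(** * Words in states and their inverses acting on sequences *)

Section Dynamics.
Variables (X : finType) (A : automaton X).
Local Open Scope nat_scope.

(* The letter (s, true) stands for the state s and (s, false) for its
   inverse; the words below are applied from left to right. *)
Notation letter := (A * bool)%type.
Implicit Types (a : letter) (g h : seq letter) (w u : nat -> X).

(** An inverse letter reading [x] moves along the arrow whose output label is [x]; this is the input
    label of the arrow actually followed. *)
Definition input a x := if a.2 then x else (output A a.1)^-1%g x.

Definition step a x : letter := (transition A a.1 (input a x), a.2).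

Definition letter_out a x :=
  if a.2 then output A a.1 x else (output A a.1)^-1%g x.

Fixpoint letter_res a w k : letter :=
  if k is l.+1 then step (letter_res a w l) (w l) else a.

Definition letter_act a w : nat -> X :=
  fun i => letter_out (letter_res a w i) (w i).

Fixpoint word_act g w : nat -> X :=
  if g is a :: g' then word_act g' (letter_act a w) else w.

Fixpoint word_res g w k : seq letter :=
  if g is a :: g' then letter_res a w k :: word_res g' (letter_act a w) k
  else [::].

Definition letter_inv a : letter := (a.1, ~~ a.2).

Definition word_inv g := rev (map letter_inv g).

Lemma letter_res_shift a w k i :
  letter_res (letter_res a w k) (shift k w) i = letter_res a w (k + i).
Proof. by elim: i => [|i ih]; rewrite ?addn0 // addnS /= ih. Qed.

Lemma letter_act_shift a w k :
  letter_act (letter_res a w k) (shift k w) = shift k (letter_act a w).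
Proof. by apply/funext => i; rewrite /letter_act letter_res_shift. Qed.

Lemma word_act_shift g w k :
  word_act (word_res g w k) (shift k w) = shift k (word_act g w).
Proof. by elim: g w => //= a g ih w; rewrite letter_act_shift ih. Qed.

Lemma word_res_add g w k i :
  word_res (word_res g w k) (shift k w) i = word_res g w (k + i).
Proof.
elim: g w => //= a g ih w.
by rewrite letter_res_shift letter_act_shift ih.
Qed.

Lemma word_res0 g w : word_res g w 0 = g.
Proof. by elim: g w => //= a g ih w; rewrite ih. Qed.

Lemma size_word_res g w k : size (word_res g w k) = size g.
Proof. by elim: g w => //= a g ih w; rewrite ih. Qed.

Lemma word_act_cat g h w : word_act (g ++ h) w = word_act h (word_act g w).
Proof. by elim: g w => //= a g ih w. Qed.

Lemma word_res_cat g h w k :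
  word_res (g ++ h) w k = word_res g w k ++ word_res h (word_act g w) k.
Proof. by elim: g w => //= a g ih w; rewrite ih. Qed.

Lemma letter_res_agree a k u w : agree k u w ->
  letter_res a u k = letter_res a w k.
Proof.
elim: k => // k ih h /=; rewrite ih ?h //.
exact: agree_le h.
Qed.

Lemma letter_act_agree a k u w : agree k u w ->
  agree k (letter_act a u) (letter_act a w).
Proof.
move=> h i ik; rewrite /letter_act h //; congr letter_out.
by apply: letter_res_agree; apply: agree_le h; apply: ltnW.
Qed.

Lemma word_act_agree g k u w : agree k u w ->
  agree k (word_act g u) (word_act g w).
Proof. by elim: g u w => //= a g ih u w h; apply/ih/letter_act_agree. Qed.

Lemma word_res_agree g k u w : agree k u w ->
  word_res g u k = word_res g w k.
Proof.
elim: g u w => //= a g ih u w h; rewrite (letter_res_agree _ h).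
by rewrite (ih _ (letter_act a w)) //; apply: letter_act_agree.
Qed.

(** Fed with the output, the inverse letter follows the same arrows, read backwards from output
    label to input label. *)
Lemma letter_res_inv a w k :
  letter_res (letter_inv a) (letter_act a w) k = letter_inv (letter_res a w k).
Proof.
elim: k => //= k ->; rewrite /step /letter_inv /letter_act /letter_out /input.
by case: letter_res => s [] /=; rewrite ?permK.
Qed.

Lemma letter_actK a : cancel (letter_act a) (letter_act (letter_inv a)).
Proof.
move=> w; apply/funext => i.
rewrite {1}/letter_act letter_res_inv /letter_out /letter_inv /letter_act /=.
by rewrite /letter_out; case: letter_res => s [] /=; rewrite ?permK ?permKV.
Qed.

Lemma word_actK g : cancel (word_act g) (word_act (word_inv g)).
Proof.
elim: g => //= a g ih w.
by rewrite /word_inv /= rev_cons -cats1 word_act_cat /= ih letter_actK.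
Qed.

(** The inverse word also preserves common prefixes, so words act by isometries. *)
Lemma agree_word_act g k u w :
  agree k (word_act g u) (word_act g w) -> agree k u w.
Proof. by move=> /(word_act_agree (word_inv g)); rewrite !word_actK. Qed.

Lemma state_actE s : state_act s = letter_act (s, true).
Proof.
apply/funext => w; apply/funext => n.
elim: n s w => [//|n ih] s w /=; rewrite ih.
have := letter_act_shift (s, true) w 1 => /(congr1 (fun f => f n)).
by rewrite /= /shift add1n => <-.
Qed.

Lemma automaton_group_word (D : {set A}) f : automaton_group D f ->
  exists2 g, all (fun a => a.1 \in D) g & f = word_act g.
Proof.
elim=> [|_ [s sD <-]|_ _ _ [g gD ->] _ [h hD ->]|_ f' _ [g gD ->] [fK Kf]].
- by exists [::].
- exists [:: (s, true)]; first by rewrite /= andbT; exact: sD.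
  by rewrite state_actE.
- exists (h ++ g); first by rewrite all_cat gD hD.
  by apply/funext => w; rewrite word_act_cat.
- exists (word_inv g).
    by rewrite /word_inv all_rev all_map.
  apply/funext => w; rewrite -{2}(Kf w).
  by rewrite word_actK.
Qed.

Lemma word_automaton_group (D : {set A}) g :
  all (fun a => a.1 \in D) g -> automaton_group D (word_act g).
Proof.
elim: g => [_|[s b] g ih /= /andP[sD /ih {}ih]]; first exact: generated_id.
have h : automaton_group D (letter_act (s, true)).
  by apply: generated_gen; exists s => //; rewrite state_actE.
apply: (@generated_comp _ _ (word_act g) (letter_act (s, b))) => //.
case: b => //; apply: (generated_inv h).
by split; [exact: letter_actK|exact: (@letter_actK (s, false))].
Qed.

End Dynamics.

(** * Levels and cycles *)

Section Levels.
Variables (X : finType) (A : automaton X) (B : {set A}).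
Hypothesis hB : subautomaton B.
Hypothesis hcycles : disjoint_cycles B.
Local Open Scope nat_scope.
Implicit Types (s t : A) (x y : X) (E F : {set A * X}).

Definition edge s t := [exists x, transition A s x == t].

Definition path_cycles s (K : {set {set A * X}}) : Prop :=
  (forall E, E \in K -> cycle_outside B E) /\
  exists2 p : seq A, path edge s p &
    forall E, E \in K -> exists2 t, t \in s :: p & t \in cycle_vertices E.

Definition level s :=
  \max_(K : {set {set A * X}} | `[< path_cycles s K >]) #|K|.

Lemma edge_transition s x : edge s (transition A s x).
Proof. by apply/existsP; exists x. Qed.

Lemma connect_transition s x : connect edge s (transition A s x).
Proof. exact/connect1/edge_transition. Qed.

Lemma level_ge s K : path_cycles s K -> #|K| <= level s.
Proof.
move=> h; rewrite /level.
by apply: (@leq_bigmax_cond _ _ (fun K : {set {set A * X}} => #|K|));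
  apply/asboolP.
Qed.

Lemma level_witness s : exists2 K, path_cycles s K & #|K| = level s.
Proof.
(* The empty family qualifies, so the maximum is attained. *)
have h0 : `[< path_cycles s finset.set0 >].
  apply/asboolP; split; first by move=> E; rewrite inE.
  by exists [::] => // E; rewrite inE.
have [|K /asboolP hK e] := @eq_bigmax_cond _
  [pred K : {set {set A * X}} | `[< path_cycles s K >]]
  (fun K : {set {set A * X}} => #|K|).
  by apply/card_gt0P; exists finset.set0.
by exists K; rewrite // -e.
Qed.

Lemma level_max s : level s <= max_connected_cycles B.
Proof.
have [K [hK [p pp hp]] <-] := level_witness s.
rewrite /max_connected_cycles.
apply: (@leq_bigmax_cond _ _ (fun K : {set {set A * X}} => #|K|)).
by apply/asboolP; split=> //; exists s, p.
Qed.

(** A path from [t] extends backwards to a path from [s] that meets the same cycles. *)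
Lemma level_connect s t : connect edge s t -> level t <= level s.
Proof.
move=> /connectP[q qq ->]; have [K [hK [p pp hp]] <-] := level_witness (last s q).
apply: level_ge; split=> //; exists (q ++ p); first by rewrite cat_path qq.
move=> E /hp[t' tp tE]; exists t' => //.
rewrite -cat_cons mem_cat; move: tp; rewrite inE => /orP[/eqP->|->].
  by rewrite mem_last.
by rewrite orbT.
Qed.

Lemma connect_sub s t : s \in B -> connect edge s t -> t \in B.
Proof.
move=> sB /connectP[p pp ->]; elim: p s sB pp => //= r p ih s sB.
by case/andP => /existsP[x /eqP <-]; apply/ih/hB.
Qed.

Lemma level_sub s : s \in B -> level s = 0.
Proof.
move=> sB; have [K [hK [p pp hp]] <-] := level_witness s.
apply/eqP; rewrite cards_eq0; apply/eqP/setP => E; rewrite inE.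
apply/negbTE/negP => EK; have [t tp] := hp _ EK.
have [c [_ /allP cB ->]] := hK _ EK.
move=> /imsetP[a]; rewrite inE => /cB aB e; move: aB; rewrite -e.
rewrite (@connect_sub s) //; move: (path_connect pp); exact.
Qed.

(** Cycles are sets of arrows, whereas [edge] forgets labels; a label is chosen here for each step
    of the path. *)
Lemma path_arrows t (p : seq A) (a : A * X) :
  path edge t p -> transition A a.1 a.2 = t ->
  exists c : seq (A * X),
    [/\ [seq b.1 | b <- c] = belast t p,
      path (fun a b => transition A a.1 a.2 == b.1) a c &
      transition A (last a c).1 (last a c).2 = last t p].
Proof.
elim: p t a => [t a _ e|t' p ih t a /= /andP[/existsP[x /eqP e] pp] ea].
  by exists [::].
have [c [h1 h2 h3]] := ih _ (t, x) pp e.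
by exists ((t, x) :: c); split; rewrite //= ?h1 // ea eqxx.
Qed.

Lemma path_connect_last t (p : seq A) r :
  path edge t p -> r \in t :: p -> connect edge r (last t p).
Proof.
elim: p t r => [t r _|t' p ih t r /= /andP[e pp]]; rewrite inE.
  by move=> /eqP->; exact: connect0.
move=> /orP[/eqP->|/(ih _ _ pp)//].
by apply: connect_trans (connect1 e) (ih _ _ pp _); rewrite mem_head.
Qed.

(** The arrow is closed up by a return path made simple, so that [s] emits only one arrow of the
    cycle. No vertex lies in [B], since [B] is closed under transitions and every vertex leads back
    to [s]. *)
Lemma arrow_cycle s x : s \notin B -> connect edge (transition A s x) s ->
  exists E, [/\ cycle_outside B E, (s, x) \in E,
    forall y, (s, y) \in E -> y = x &
    forall t, t \in cycle_vertices E -> connect edge t s].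
Proof.
move=> sB /connectP[p0 pp0]; set t := transition A s x.
case: (shortenP pp0) => p pp up _ es.
have [c [cm cp cl]] := path_arrows (a := (s, x)) pp erefl.
have uc : uniq [seq b.1 | b <- (s, x) :: c].
  by rewrite map_cons cm /=; move: up; rewrite lastI rcons_uniq -es.
have cc : cycle (fun a b : A * X => transition A a.1 a.2 == b.1) ((s, x) :: c).
  by rewrite /= rcons_path cp /= cl -es.
have con r : r \in [seq b.1 | b <- (s, x) :: c] -> connect edge r s.
  rewrite map_cons cm inE => /orP[/eqP->|]; first exact: connect0.
  by move=> /mem_belast rp; rewrite [s in connect _ _ s]es; apply: path_connect_last rp.
exists [set:: (s, x) :: c]%SET; split.
- exists ((s, x) :: c); split=> //; first by rewrite /simple_closed_path uc cc.
  apply/allP => b bc; apply: contra sB => bB.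
  by apply: connect_sub bB (con _ _); apply: map_f.
- by rewrite !inE eqxx.
- move=> y; rewrite inE; move: uc => /=/andP[h _].
  rewrite inE => /orP[/eqP[//]|yc].
  by move: h => /negP[]; apply/mapP; exists (s, y).
- by move=> r /imsetP[b]; rewrite inE => bc ->; apply/con/map_f.
Qed.

Definition recurrent s := [exists x, connect edge (transition A s x) s].

Definition cyclic s := (s \notin B) && recurrent s.

Lemma cyclic_level_gt0 s : cyclic s -> 0 < level s.
Proof.
move=> /andP[sB /existsP[x /(arrow_cycle sB)[E [hE xE _ _]]]].
rewrite -(cards1 E); apply: level_ge; split; first by move=> F /set1P->.
exists [::] => // F /set1P->; exists s; first by rewrite inE.
by apply/imsetP; exists (s, x).
Qed.

(* Leaving a cycle costs a cycle: a path from the new state meeting as many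
   cycles either misses the cycle just left, which can then be added to it, or
   returns to it, which yields a second cycle through s. *)
Lemma level_exit s x y : s \notin B -> connect edge (transition A s x) s ->
  y <> x -> level (transition A s y) < level s.
Proof.
move=> sB /(arrow_cycle sB)[E [hE xE uE vE]] yx.
set t := transition A s y; have [K [hK [p pp hp]] <-] := level_witness t.
have sE : s \in cycle_vertices E by apply/imsetP; exists (s, x).
have [EK|EK] := boolP (E \in K).
  have [r rp rE] := hp _ EK.
  have ts : connect edge t s by exact: connect_trans (path_connect pp rp) (vE _ rE).
  have [F [hF yF _ vF]] := arrow_cycle sB ts.
  have EF : E <> F by move=> e; apply/yx/uE; rewrite e.
  have /disjoint_setI0/setP/(_ s) := hcycles hE hF EF.
  by rewrite !inE sE; move=> /negbT/negP[]; apply/imsetP; exists (s, y).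
have <- : #|E |: K|%SET = #|K|.+1 by rewrite cardsU1 EK.
apply: level_ge; split; first by move=> F /setU1P[->//|/hK].
exists (t :: p) => [|F /setU1P[->|/hp[r rp rF]]].
- by rewrite /= edge_transition.
- by exists s; rewrite // inE eqxx.
- by exists r; rewrite // inE rp orbT.
Qed.

Lemma recurrent_succ s x : connect edge (transition A s x) s ->
  recurrent (transition A s x).
Proof.
move et : (transition A s x) => t /connectP[[|r p] /= pp e].
  by apply/existsP; exists x; rewrite -{1}e et connect0.
move: pp => /andP[/existsP[y /eqP er] pp]; apply/existsP; exists y.
apply: (@connect_trans _ _ s); last by rewrite -et connect_transition.
by rewrite er e; apply/connectP; exists p.
Qed.

End Levels.

(** * Blocks *)

Section Blocks.
Variables (X : finType) (A : automaton X) (B : {set A}) (x0 : X).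
Hypothesis hB : subautomaton B.
Hypothesis hcycles : disjoint_cycles B.
Local Open Scope nat_scope.
Local Notation letter := (A * bool)%type.
Local Notation edge := (@edge X A).
Local Notation level := (@level X A B).
Local Notation cyclic := (cyclic B).
Implicit Types (s t : A) (x y : X) (a : letter) (g h T : seq letter).
Implicit Types (w u p q : nat -> X).

(* The value x0 is a dummy, used only for states lying on no cycle. *)
Definition stay s : X :=
  odflt x0 [pick x | connect edge (transition A s x) s].

Definition cycle_next s := transition A s (stay s).

(** For [cyclic s] this is the one input along which the level never drops; [cycle_out] is its
    image. *)
Definition cycle_in s : nat -> X := fun i => stay (iter i cycle_next s).

Definition cycle_out s : nat -> X :=
  fun i => output A (iter i cycle_next s) (cycle_in s i).

(** All sequences at which blocks can begin or end. This list is finite and closed under shifts,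
    which yields separation thresholds that do not depend on the block. *)
Definition special : seq (nat -> X) := codom cycle_in ++ codom cycle_out.

Lemma special_shift k p : p \in special -> shift k p \in special.
Proof.
have e i s : iter (k + i) cycle_next s = iter i cycle_next (iter k cycle_next s).
  by rewrite addnC iterD.
rewrite !mem_cat => /orP[]/codomP[s ->]; apply/orP; [left|right].
  apply/codomP; exists (iter k cycle_next s).
  by apply/funext => i; rewrite /shift /cycle_in e.
apply/codomP; exists (iter k cycle_next s).
by apply/funext => i; rewrite /shift /cycle_out /cycle_in e.
Qed.

Lemma cyclic_stay s x : cyclic s -> level (transition A s x) = level s ->
  x = stay s /\ cyclic (transition A s x).
Proof.
move=> /andP[sB /existsP[y cy]] lx.
have sy : connect edge (transition A s (stay s)) s.
  by rewrite /stay; case: pickP => [z //|/(_ y)]; rewrite cy.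
have e : x = stay s.
  have [//|/eqP ne] := eqVneq x (stay s).
  by have := level_exit hB hcycles sB sy ne; rewrite lx ltnn.
split=> //; rewrite e; apply/andP; split; last exact: recurrent_succ.
by apply: contra sB => h; apply: (connect_sub hB h).
Qed.

(** An inverse letter reads what its state writes, so the two sequences of the cycle change
    roles. *)
Definition entry a := if a.2 then cycle_in a.1 else cycle_out a.1.
Definition exit a := if a.2 then cycle_out a.1 else cycle_in a.1.

Lemma entry_special a : entry a \in special.
Proof.
by rewrite /entry mem_cat; case: a.2; rewrite codom_f ?orbT.
Qed.

Lemma exit_special a : exit a \in special.
Proof.
by rewrite /exit mem_cat; case: a.2; rewrite codom_f ?orbT.
Qed.

Lemma input_entry a i :
  input (iter i cycle_next a.1, a.2) (entry a i) = cycle_in a.1 i.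
Proof.
by rewrite /input /entry; case: a => s [] //=; rewrite /cycle_out permK.
Qed.

Lemma letter_res_entry a k :
  letter_res a (entry a) k = (iter k cycle_next a.1, a.2).
Proof.
elim: k => [|k ih]; first by case: a.
by rewrite /= ih /step input_entry /=.
Qed.

Lemma letter_act_entry a : letter_act a (entry a) = exit a.
Proof.
apply/funext => i; rewrite /letter_act letter_res_entry /letter_out /=.
by rewrite /entry /exit; case: a.2; rewrite /cycle_out ?permK.
Qed.

Lemma letter_res_connect a w i j : i <= j ->
  connect edge (letter_res a w i).1 (letter_res a w j).1.
Proof.
move=> /subnKC <-; elim: (j - i) => [|k ih]; first by rewrite addn0.
by rewrite addnS; apply: connect_trans ih (connect_transition _ _).
Qed.

Lemma letter_res_level a w i j : i <= j ->
  level (letter_res a w j).1 <= level (letter_res a w i).1.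
Proof. by move=> ij; apply/level_connect/letter_res_connect. Qed.

(** Levels never increase, so equality after [k] steps forces it at every earlier step, and each
    step must then follow the cycle. For an inverse letter the letter read is recovered because
    outputs are permutations. *)
Lemma letter_res_stay a w k : cyclic a.1 ->
  level (letter_res a w k).1 = level a.1 ->
  [/\ agree k w (entry a), letter_res a w k = (iter k cycle_next a.1, a.2) &
      cyclic (letter_res a w k).1].
Proof.
move=> ca; elim: k => [_|k ih lk]; first by split=> //; case: (a).
have lk' : level (letter_res a w k).1 = level a.1.
  apply/eqP; rewrite eqn_leq -{2}lk (@letter_res_level a w 0) //.
  by rewrite letter_res_level.
have [ag e ck] := ih lk'.
have [|es cs] := @cyclic_stay _ (input (letter_res a w k) (w k)) ck.
  by rewrite lk'.
split=> // [i|]; last by rewrite /= /step es e.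
rewrite ltnS leq_eqVlt => /orP[/eqP ->|/ag //].
move: es; rewrite e /= => es; have := input_entry a k.
rewrite -[cycle_in a.1 k]es /input /=; case: a.2 => // /perm_inj ->//.
Qed.

Lemma letter_exit a w l : cyclic a.1 -> w l <> entry a l ->
  level (letter_res a w l.+1).1 < level a.1.
Proof.
move=> ca ne; have := letter_res_level a w (leq0n l.+1).
rewrite leq_eqVlt => /orP[/eqP e|//].
by have [/(_ l (ltnSn l)) /ne] := letter_res_stay ca e.
Qed.

(** Pigeonhole: among the first [#|A|.+1] states one occurs twice. *)
Lemma letter_res_recurrent a w :
  exists2 i, i <= #|A| & exists x,
    let s := (letter_res a w i).1 in
    transition A s x = (letter_res a w i.+1).1 /\
    connect edge (transition A s x) s.
Proof.
pose f (i : 'I_#|A|.+1) := (letter_res a w i).1.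
have /injectivePn[i [j ij eij]] : ~~ injectiveb f.
  apply/negP => /injectiveP /leq_card; rewrite card_ord; lia.
wlog lij : i j ij eij / i < j.
  move=> H; case: (ltngtP i j) => [|/H|/ord_inj e]; first exact: H.
    by apply; rewrite // eq_sym.
  by rewrite e eqxx in ij.
exists i; first by rewrite -ltnS.
exists (input (letter_res a w i) (w i)); split=> //.
rewrite -/(f i) [f i in X in connect _ _ X]eij.
exact: (@letter_res_connect a w i.+1 j).
Qed.

(** The repeated state is recurrent, and its positive level keeps it out of [B]. From then on an
    unchanged level means following the cycle. *)
Lemma letter_res_cyclic a w : 0 < level a.1 ->
  level (letter_res a w #|A|).1 = level a.1 ->
  cyclic (letter_res a w #|A|).1.
Proof.
move=> a0 lM; have [i iM [x /= [ex cx]]] := letter_res_recurrent a w.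
have lev j : j <= #|A| -> level (letter_res a w j).1 = level a.1.
  move=> jM; apply/eqP; rewrite eqn_leq -{2}lM letter_res_level //.
  by rewrite (@letter_res_level a w 0).
have ci : cyclic (letter_res a w i).1.
  apply/andP; split; last by apply/existsP; exists x.
  by apply/negP => /level_sub e; move: a0; rewrite -(lev i iM) e.
rewrite -(subnKC iM); move: (subnKC iM) lev; move: (#|A| - i) => d <- lev.
elim: d {iM lM} lev => [|d ih] lev; first by rewrite addn0.
rewrite addnS; apply: (cyclic_stay _ _).2.
  by apply: ih => j jd; apply: lev; rewrite addnS ltnW.
rewrite [RHS]lev ?addnS ?leqnSn //.
by have := lev (i + d.+1); rewrite addnS; apply.
Qed.

(** A repeated state outside [B] would have positive level; once in [B], the run stays there. *)
Lemma letter_res_sub a w : level a.1 = 0 -> (letter_res a w #|A|).1 \in B.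
Proof.
move=> a0; have [i iM [x /= [ex cx]]] := letter_res_recurrent a w.
apply: (connect_sub hB) (letter_res_connect a w iM).
apply/negPn/negP => sB; have := letter_res_level a w (leq0n i).
rewrite a0 leqNgt cyclic_level_gt0 // /is_true.
by apply/andP; split=> //; apply/existsP; exists x.
Qed.

(** * Lower-level words, blocks and decompositions into blocks *)

Definition below j g := all (fun a => level a.1 < j) g.

Lemma below_cat j g h : below j (g ++ h) = below j g && below j h.
Proof. exact: all_cat. Qed.

Lemma below_res j g w k : below j g -> below j (word_res g w k).
Proof.
elim: g w => //= a g ih w /andP[la /ih ->]; rewrite andbT.
exact: leq_ltn_trans (letter_res_level a w (leq0n k)) la.
Qed.

Lemma below_res_le j g w k l : k <= l ->
  below j (word_res g w k) -> below j (word_res g w l).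
Proof. by move=> /subnKC <- h; rewrite -word_res_add below_res. Qed.

(* A block behaves like a single state on a cycle: along p it stays on its
   cycles, and as soon as the input leaves p all its letters drop in level. *)
Definition block j T p q :=
  word_act T p = q /\
  forall w l, w l <> p l -> below j (word_res T w l.+1).

Lemma block_letter j a : cyclic a.1 -> level a.1 = j ->
  block j [:: a] (entry a) (exit a).
Proof.
move=> ca <-; split; first exact: letter_act_entry.
by move=> w l ne; rewrite /= andbT letter_exit.
Qed.

Lemma block_leave j T p q w k : block j T p q -> ~ agree k w p ->
  below j (word_res T w k).
Proof.
move=> [_ hT] nag; have [/nag//|[l lk [_ ne]]] := agreeVdiff k w p.
exact: below_res_le lk (hT _ _ ne).
Qed.

(** The actions preserve the exact length of common prefixes. Hence an input leaving [p] at some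
    position makes the sequence entering [T'] leave [p'] by that position, and both blocks have
    dropped one step later. *)
Lemma block_cat j T p q h T' p' q' : block j T p q -> below j h ->
  word_act h q = p' -> block j T' p' q' -> block j (T ++ h ++ T') p q'.
Proof.
move=> bT hh hq bT'; split; first by rewrite !word_act_cat bT.1 hq bT'.1.
move=> w l ne; rewrite !word_res_cat !below_cat bT.2 //=.
rewrite below_res //= (block_leave bT') //.
rewrite -hq -bT.1 => /agree_word_act/agree_word_act /(_ l (ltnSn l)).
exact: ne.
Qed.

Lemma block_res j T p q w k : block j T p q -> agree k w p ->
  block j (word_res T w k) (shift k p) (shift k q).
Proof.
move=> [hq hT] ag; rewrite (word_res_agree _ ag); split.
  by rewrite word_act_shift hq.
(* The restricted word is tested on [u] by prepending the first [k] letters of [p], which returns to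
   the original block. *)
move=> u l ne; have e : agree k (wcat (mkseq p k) u) p by exact: agree_wcat.
have eu := shift_wcat_mkseq k p u.
rewrite -(word_res_agree T e) -{2}eu word_res_add addnS; apply: hT.
by move: ne; rewrite -{1}eu.
Qed.

(** The index only bounds the number of blocks from above, so blocks may dissolve without a
    recount. *)
Inductive decomposed j : nat -> seq letter -> Prop :=
| decomposed_below r g of below j g : decomposed j r g
| decomposed_block r h T g p q of below j h & block j T p q &
    p \in special & q \in special & decomposed j r g :
    decomposed j r.+1 (h ++ T ++ g).

Lemma decomposed_cat j r h g : below j h -> decomposed j r g ->
  decomposed j r (h ++ g).
Proof.
move=> bh dg; case: dg bh => [r' g' bg|r' h' T g' p q bh' bT sp sq dg] bh.
  by apply: decomposed_below; rewrite below_cat bh.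
rewrite catA; apply: decomposed_block bT sp sq dg.
by rewrite below_cat bh.
Qed.

Lemma decomposed_le j r r' g : r <= r' -> decomposed j r g ->
  decomposed j r' g.
Proof.
move=> + dg; elim: dg r' => [{}r {}g bg r' _|{}r h T {}g p q bh bT sp sq _ ih r'].
  exact: decomposed_below.
by case: r' => // r' /ih dg'; exact: decomposed_block bT sp sq dg'.
Qed.

(** A block whose input follows [p] survives, shifted; otherwise it becomes a lower-level word,
    absorbed into what comes next. *)
Lemma decomposed_block_res j T p q r g w k : block j T p q ->
  p \in special -> q \in special -> decomposed j r g ->
  decomposed j r.+1 (word_res T w k ++ g).
Proof.
move=> bT sp sq dg; have [ag|nag] := pselect (agree k w p).
  apply: (@decomposed_block _ _ [::] _ _ (shift k p) (shift k q)) => //.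
  - exact: block_res.
  - exact: special_shift.
  - exact: special_shift.
apply: decomposed_cat; first exact: block_leave bT nag.
exact: decomposed_le dg.
Qed.

(** After [#|A|] steps every letter still at level [j] is on its cycle and forms a block by
    itself. *)
Lemma decomposed_init j g w : 0 < j -> below j.+1 g ->
  decomposed j (size g) (word_res g w #|A|).
Proof.
move=> j0; elim: g w => [|a g ih] w /=; first by move=> _; exact: decomposed_below.
move=> /andP[la /ih {}ih]; set b := letter_res a w #|A|.
have /orP[/eqP lb|lb] : (level b.1 == j) || (level b.1 < j).
    by rewrite -leq_eqVlt; apply: leq_trans (letter_res_level a w (leq0n _)) _.
  apply: (@decomposed_block _ _ [::] [:: b] _ (entry b) (exit b)) => //.
  - apply: block_letter => //; apply: letter_res_cyclic.
      apply: leq_trans (letter_res_level a w (leq0n #|A|)).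
      by rewrite -/b lb.
    apply/eqP; rewrite eqn_leq (letter_res_level a w (leq0n #|A|)) /=.
    by rewrite -/b lb -ltnS.
  - exact: entry_special.
  - exact: exit_special.
rewrite -cat1s; apply: decomposed_cat; first by rewrite /= lb.
exact: decomposed_le (ih _).
Qed.

(** The number [k] is a depth at which the test for fitting two blocks together becomes decisive,
    uniformly over the linking words of length at most [n]. *)
Definition separates j n k := forall h p q, below j h -> size h <= n ->
  q \in special -> p \in special ->
  agree k (word_act h q) p -> word_act h q = p.

Lemma separates_le j n k l : k <= l -> separates j n k -> separates j n l.
Proof. by move=> kl h g p q bg sg sq sp ag; apply: h => //; apply: agree_le ag. Qed.

(* Two consecutive blocks linked by a word of lower level either fit together
   into one block, or cannot both survive k steps. *)
Lemma decomposed_half j n k r g w : separates j n k -> size g <= n ->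
  decomposed j r g -> decomposed j (uphalf r) (word_res g w k).
Proof.
move=> sep; have [m] := ubnP r; elim: m r g w => // m ih r g w rm sg dg.
case: dg rm sg => {r g} [r g bg _ _|r h T g p q bh bT sp sq dg].
  by apply: decomposed_below; apply: below_res.
case: dg => {r g} [r g bg _ _|r h' T' g p' q' bh' bT' sp' sq' dg rm sg].
  rewrite !word_res_cat; apply: decomposed_cat; first exact: below_res.
  apply: (decomposed_block_res _ _ bT sp sq).
  by apply: decomposed_below; apply: below_res.
have {}dg v : decomposed j (uphalf r) (word_res g v k).
  apply: ih => //; first by lia.
  by move: sg; rewrite !size_cat; lia.
have sh' : size h' <= n by move: sg; rewrite !size_cat; lia.
rewrite word_res_cat; apply: decomposed_cat; first exact: below_res.
rewrite /=; set v := word_act h w.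
have [e|ne] := pselect (word_act h' q = p').
  have := block_cat bT bh' e bT'.
  move=> /(decomposed_block_res v k)/(_ sp sq' (dg (word_act (T ++ h' ++ T') v))).
  by rewrite !word_res_cat -!catA !word_act_cat.
rewrite !word_res_cat !catA; set v' := word_act T v.
have [ag|nag] := pselect (agree k v p); last first.
  rewrite -!catA; apply: decomposed_cat; first exact: block_leave bT nag.
  apply: decomposed_cat; first exact: below_res.
  exact: decomposed_block_res bT' sp' sq' (dg _).
rewrite -!catA; apply: (decomposed_block_res _ _ bT sp sq).
apply: decomposed_cat; first exact: below_res.
(* The first block survives, so its output agrees with [q] on [k] letters. Were the second to
   survive too, [h'] would send [q] to a sequence agreeing with [p'] on [k] letters, and [sep] would
   make the blocks fit. *)
apply: decomposed_cat (dg _); apply: (block_leave bT') => ag'.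
apply/ne/sep => //; apply: agree_trans ag'.
apply: word_act_agree; rewrite -bT.1.
by apply/word_act_agree/agree_sym.
Qed.

Lemma decomposed_iter j n k i g w : separates j n k -> size g <= n ->
  decomposed j (2 ^ i) g -> decomposed j 1 (word_res g w (i * k)).
Proof.
move=> sep; elim: i g w => [|i ih] g w sg; first by rewrite word_res0.
move=> /(decomposed_half w sep sg); have -> : uphalf (2 ^ i.+1) = 2 ^ i.
  by rewrite expnS mul2n uphalf_double.
rewrite mulSn -word_res_add; apply: ih.
by rewrite size_word_res.
Qed.

Lemma decomposed1 j n k i g w : 0 < j -> separates j n k -> n <= 2 ^ i ->
  below j.+1 g -> size g <= n -> decomposed j 1 (word_res g w (#|A| + i * k)).
Proof.
move=> j0 sep ni bg sg; rewrite -word_res_add; apply: (decomposed_iter _ sep).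
  by rewrite size_word_res.
apply: decomposed_le (decomposed_init w j0 bg).
exact: leq_trans sg ni.
Qed.

Lemma decomposed1_inv j g : decomposed j 1 g -> below j g \/
  exists h T h' p q, [/\ g = h ++ T ++ h', below j h /\ below j h',
    block j T p q, p \in special & q \in special].
Proof.
move: {1 3}1 (erefl 1) => r er dg.
case: dg er => [{}r {}g bg _|{}r h T {}g p q bh bT sp sq dg [er]]; first by left.
right; exists h, T, g, p, q; split=> //; split=> //.
by case: dg er.
Qed.

(** After [D] steps at most one block is left, between words [h] and [h']. If [h] sends [q] to its
    entry up to depth [k], it does so exactly, the block has a special output, and only [h'] remains
    to be tested. Otherwise the block dissolves within [k] steps, and [k] more letters decide for
    the resulting lower-level word. *)
Lemma separates_succ j n k i : 0 < j -> n <= 2 ^ i -> separates j n k ->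
  separates j.+1 n (#|A| + i * k + k + k).
Proof.
move=> j0 ni sep g p q bg sg sq sp ag; set D := #|A| + i * k in ag *.
have := decomposed1 q j0 sep ni bg sg; rewrite -/D => dg.
apply: (@agree_shift_eq _ D); first by apply: agree_le ag; lia.
rewrite -word_act_shift.
have {ag} : agree (k + k) (word_act (word_res g q D) (shift D q)) (shift D p).
  by rewrite word_act_shift; apply: agree_shift; rewrite addnA.
have {sg} : size (word_res g q D) <= n by rewrite size_word_res.
move: dg (special_shift D sq) (special_shift D sp).
move: (shift D q) (shift D p) (word_res g q D) => {bg sq sp}q {}p {}g dg sq sp sg.
move=> ag; have sep' u v h : below j h -> size h <= n -> u \in special ->
    v \in special -> agree k (word_act h u) v -> word_act h u = v.
  by move=> *; apply: sep.
have [bg|[h [T [h' [p' [q' [eg [bh bh'] bT sp' sq']]]]]]] := decomposed1_inv dg.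
  by apply: sep' => //; apply: agree_le ag; lia.
have [ag'|nag] := pselect (agree k (word_act h q) p').
  move: ag sg; rewrite eg !word_act_cat !size_cat => ag sg.
  have e : word_act h q = p' by apply: sep' => //; lia.
  move: ag; rewrite e bT.1 => ag; apply: sep' => //; first by lia.
  by apply: agree_le ag; lia.
apply: (@agree_shift_eq _ k); first by apply: agree_le ag; lia.
rewrite -word_act_shift; apply: sep'; rewrite ?size_word_res ?special_shift //.
  rewrite eg !word_res_cat !below_cat; apply/and3P; split.
  - exact: below_res.
  - exact: block_leave bT nag.
  - exact: below_res.
by rewrite word_act_shift; exact: agree_shift.
Qed.

End Blocks.

(** * Counting orbit points *)

Section Coverings.
Variable T : choiceType.
Local Open Scope nat_scope.
Implicit Types (E : set T) (N M : nat).

Definition covered E N := exists2 s : seq T, size s <= N & forall x, E x -> x \in s.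

Lemma covered_le E N M : N <= M -> covered E N -> covered E M.
Proof. by move=> NM [s sN hs]; exists s => //; apply: leq_trans NM. Qed.

Lemma covered_sub E F N : E `<=` F -> covered F N -> covered E N.
Proof. by move=> EF [s sN hs]; exists s => // x /EF/hs. Qed.

Lemma covered1 x : covered [set x] 1.
Proof. by exists [:: x] => // y ->; rewrite mem_head. Qed.

Lemma covered_seq (s : seq T) : covered [set` s] (size s).
Proof. by exists s. Qed.

Lemma coveredU E F N M : covered E N -> covered F M ->
  covered (E `|` F) (N + M).
Proof.
move=> [s sN hs] [t tM ht]; exists (s ++ t); first by rewrite size_cat leq_add.
by move=> x [/hs|/ht] xs; rewrite mem_cat xs ?orbT.
Qed.

Lemma covered_bind (E : set T) (F : T -> set T) N M :
  covered E N -> (forall x, E x -> covered (F x) M) ->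
  covered [set y | exists2 x, E x & F x y] (N * M).
Proof.
move=> [s sN hs] hF.
have /choice[f hf] : forall x, exists t : seq T,
    size t <= M /\ (E x -> forall y, F x y -> y \in t).
  move=> x; have [/hF[t tM ht]|nE] := pselect (E x); first by exists t.
  by exists [::]; split=> // /nE.
exists (flatten [seq f x | x <- s]).
  apply: leq_trans (leq_mul sN (leqnn M)).
  elim: {sN hs}s => //= x s ih; rewrite size_cat mulSn leq_add //.
  by have [] := hf x.
move=> y [x Ex Fy]; apply/flatten_mapP; exists x; first exact: hs.
exact: (hf x).2.
Qed.

Lemma covered_card E N : covered E N -> #|` fset_set E| <= N.
Proof.
move=> [s sN hs]; have fE : finite_set E.
  by apply: (@sub_finite_set _ _ [set` s]); [move=> x /hs|exact: finite_seq].
apply: leq_trans sN; apply: (@leq_trans #|` [fset x in s]%fset|).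
  apply: fsubset_leq_card; apply/fsubsetP => x; rewrite in_fset_set //.
  by rewrite inE => /hs xs; rewrite !inE.
by rewrite card_fseq size_undup.
Qed.

Lemma seq_bound (I : eqType) (P : I -> nat -> Prop) (s : seq I) :
  (forall x m n, m <= n -> P x m -> P x n) ->
  (forall x, x \in s -> exists n, P x n) ->
  exists n, forall x, x \in s -> P x n.
Proof.
move=> mono; elim: s => [_|x s ih h]; first by exists 0.
have [|n hn] := ih; first by move=> y ys; apply: h; rewrite inE ys orbT.
have [m hm] := h x (mem_head _ _).
exists (m + n) => y; rewrite inE => /orP[/eqP->|/hn hy].
  by apply: mono hm; apply: leq_addr.
by apply: mono hy; apply: leq_addl.
Qed.

End Coverings.

(** * Composition of restrictions *)

Section Restrictions.
Variable X : Type.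
Local Open Scope nat_scope.
Implicit Types (f g : (nat -> X) -> (nat -> X)) (u v : seq X).

Lemma wcat_nil (w : nat -> X) : wcat [::] w = w.
Proof. by apply/funext => n; rewrite /wcat subn0 nth_nil. Qed.

Lemma wcat_cat u v (w : nat -> X) : wcat (u ++ v) w = wcat u (wcat v w).
Proof.
apply/funext => n; rewrite /wcat nth_cat size_cat subnDA.
case: ltnP => nu; first exact: set_nth_default.
by rewrite [in RHS]nth_default.
Qed.

Lemma restriction_nil f : is_restriction f [::] f.
Proof. by exists [::]; split=> // w; rewrite !wcat_nil. Qed.

Lemma restriction_cat f f1 f2 u v : is_restriction f u f1 ->
  is_restriction f1 v f2 -> is_restriction f (u ++ v) f2.
Proof.
move=> [u' [su hu]] [v' [sv hv]]; exists (u' ++ v').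
rewrite !size_cat su sv; split=> // w.
by rewrite !wcat_cat hu hv.
Qed.

(** Here [u] is the image of the prefix [v] under [f]; the outer map must be restricted there. *)
Lemma restriction_comp f f1 g v : is_restriction f v f1 ->
  exists2 u, size u = size v &
    forall g1, is_restriction g u g1 -> is_restriction (g \o f) v (g1 \o f1).
Proof.
move=> [u [su hu]]; exists u => // g1 [u' [su' hu']]; exists u'.
by rewrite su' su; split=> // w /=; rewrite hu hu'.
Qed.

End Restrictions.

(** * Separation depths and orbit bounds, level by level *)

Section Growth.
Variables (X : finType) (A : automaton X) (B : {set A}) (x0 : X).
Hypothesis hX : (1 < #|X|)%N.
Hypothesis hB : subautomaton B.
Hypothesis hcycles : disjoint_cycles B.
Hypothesis hcontr : contracting (automaton_group B).
Local Open Scope nat_scope.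
Local Notation letter := (A * bool)%type.
Local Notation transformation := ((nat -> X) -> (nat -> X)).
Local Notation level := (@level X A B).
Local Notation below := (@below X A B).
Local Notation block := (@block X A B).
Local Notation special := (special A x0).
Local Notation separates := (@separates X A B x0).
Implicit Types (g h T : seq letter) (w u p q : nat -> X).

Lemma covered_shift D (E : set (nat -> X)) N : covered E N ->
  covered [set u | E (shift D u)] (#|X| ^ D * N).
Proof.
move=> [s sN hs].
exists [seq wcat (tval v) z | v <- enum {: D.-tuple X}, z <- s].
  by rewrite size_allpairs -cardE card_tuple leq_mul2l sN orbT.
move=> u /= /hs us; rewrite -(wcat_mkseq D u).
apply: (allpairs_f (fun (v : D.-tuple X) z => wcat v z)
  (x := [tuple of mkseq u D])) => //.
by rewrite mem_enum.
Qed.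

Definition word_ball j n w : set (nat -> X) :=
  [set u | exists g, [/\ below j g, size g <= n & word_act g w = u]].

(** The place [l] where [w] leaves [p] does not depend on [T]. Before it the output copies [q], at
    it any letter may occur, and after it a lower-level word acts on a fixed tail. The successor
    allows for [w = p], where the output is [q]. *)
Lemma covered_block j n F p q w : (forall w, covered (word_ball j n w) F) ->
  covered [set u | exists T, [/\ block j T p q, size T <= n & word_act T w = u]]
    (#|X| * F).+1.
Proof.
move=> hF; have [->|ne] := pselect (w = p).
  apply: (@covered_le _ _ 1) => //.
  by apply: covered_sub (covered1 q) => u [T [[<- _] _ <-]].
have [l [ag nl]] : exists l, agree l w p /\ w l <> p l.
  apply: contrapT => h; apply: ne; apply: agree_all => k.
  by have [//|[l _ hl]] := agreeVdiff k w p; case: h; exists l.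
have [s sF hs] := hF (shift l.+1 w).
exists [seq wcat (rcons (mkseq q l) a) z | a <- enum X, z <- s].
  by rewrite size_allpairs -cardE ltnW // ltnS leq_mul2l sF orbT.
move=> u [T [[hq hT] sT <-]]; set u' := word_act T w.
rewrite -(wcat_mkseq l.+1 u').
have -> : mkseq u' l.+1 = rcons (mkseq q l) (u' l).
  rewrite /mkseq -addn1 iotaD map_cat cats1 add0n; congr rcons.
  apply/eq_in_map => i; rewrite mem_iota add0n => /andP[_ il].
  by rewrite -hq; apply: word_act_agree il.
apply: (allpairs_f (fun a z => wcat (rcons (mkseq q l) a) z)).
  by rewrite mem_enum.
apply: hs; exists (word_res T w l.+1); split; first exact: hT.
  by rewrite size_word_res.
exact: word_act_shift.
Qed.

(** The power of [#|X|] counts the first [D] output letters. On the tail acts either a lower-level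
    word, or such a word, a block and another such word; the two factors [size special] choose the
    ends of the block. *)
Lemma word_ball_succ j n k i F w : 0 < j -> n <= 2 ^ i -> separates j n k ->
  (forall w, covered (word_ball j n w) F) ->
  covered (word_ball j.+1 n w)
    (#|X| ^ (#|A| + i * k) *
      (F + F * (size special * (size special * (#|X| * F).+1) * F))).
Proof.
move=> j0 ni sep hF; set D := _ + _.
set Mid := fun v u => exists2 p, [set` special] p & exists2 q,
  [set` special] q & exists T, [/\ block j T p q, size T <= n & word_act T v = u].
pose E := word_ball j n (shift D w) `|`
  [set u | exists2 v, word_ball j n (shift D w) v &
     exists2 v', Mid v v' & word_ball j n v' u].
apply: (@covered_sub _ _ [set u | E (shift D u)]) => [_ [g [bg sg <-]]|].
  rewrite /= -word_act_shift.
  have := decomposed1 hB hcycles w j0 sep ni bg sg; rewrite -/D.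
  have : size (word_res g w D) <= n by rewrite size_word_res.
  move: (word_res g w D) => {bg sg}g sg.
  case/decomposed1_inv => [bg|[h [T [h' [p [q [eg [bh bh'] bT sp sq]]]]]]].
    by left; exists g.
  right; move: sg; rewrite eg !size_cat => sg.
  exists (word_act h (shift D w)); first by exists h; split=> //; lia.
  exists (word_act T (word_act h (shift D w))); last first.
    by exists h'; split; rewrite ?word_act_cat //; lia.
  exists p => //; exists q => //; exists T; split=> //; lia.
apply/covered_shift/coveredU; first exact: hF.
apply: covered_bind => [|v _]; first exact: hF.
apply: covered_bind => [|v' _]; last exact: hF.
apply: covered_bind => [|p _]; first exact: covered_seq.
apply: covered_bind => [|q _]; first exact: covered_seq.
exact: covered_block.
Qed.

(** Doubling: each half of a word restricts into the finite list [E] after [d * i] letters, and a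
    product of two elements of [E] restricts into [E] after [d] more. *)
Lemma contracting_words : exists (E : seq transformation) (d : nat),
  forall i g v, all (fun a => a.1 \in B) g -> size g <= 2 ^ i ->
    size v = d * i ->
    exists2 e, e \in E & is_restriction (word_act g) v e.
Proof.
have [N [/finite_seqP[Ns eN] NH hN]] := hcontr.
pose E := idfun :: Ns ++
  [seq @letter_act X A a | a <- enum [pred a : letter | a.1 \in B]].
have EH e : e \in E -> automaton_group B e.
  rewrite inE mem_cat => /or3P[/eqP->||/mapP[a aB ->]].
  - exact: generated_id.
  - by move=> eNs; apply: NH; rewrite eN.
  - apply: (@word_automaton_group _ _ _ [:: a]).
    by move: aB; rewrite mem_enum inE /= andbT.
(* Contraction gives a depth for each of the finitely many products of two elements of [E]; [d]
   serves for all. *)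
have [||d hd] := @seq_bound _ (fun (ee : transformation * transformation) n =>
    forall v : seq X, n <= size v -> exists2 e, e \in E & is_restriction (ee.2 \o ee.1) v e)
    [seq (e, e') | e <- E, e' <- E].
- by move=> ee m n mn h v nv; apply: h; apply: leq_trans nv.
- move=> _ /allpairsP[[e e'] /= [/EH eH /EH eH' ->]] /=.
  have [n hn] := hN _ (generated_comp eH' eH).
  exists n => v /hn[f Nf rf]; exists f => //.
  by rewrite inE mem_cat; move: Nf; rewrite eN /= => ->; rewrite orbT.
exists E, d; elim=> [|i ih] g v gB sg sv.
  have -> : v = [::] by apply: size0nil; rewrite sv muln0.
  case: g sg gB => [|a [|//]] _ /= aB.
    by exists idfun; [rewrite mem_head|exact: restriction_nil].
  exists (@letter_act X A a); last exact: restriction_nil.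
  rewrite inE mem_cat; apply/or3P/Or33/map_f.
  by rewrite mem_enum inE; move: aB; rewrite andbT.
rewrite -(cat_take_drop (d * i) v) -(cat_take_drop (2 ^ i) g).
move: gB; rewrite -{1}(cat_take_drop (2 ^ i) g) all_cat => /andP[gB1 gB2].
have sv1 : size (take (d * i) v) = d * i.
  by rewrite size_takel // sv leq_mul2l leqnSn orbT.
have [|e1 E1 r1] := ih _ _ gB1 _ sv1.
  by rewrite size_take_min geq_minl.
have [u su hu] := restriction_comp (word_act (drop (2 ^ i) g)) r1.
have [||e2 E2 r2] := ih _ u gB2.
- by rewrite size_drop; move: sg; rewrite expnS; lia.
- by rewrite su.
have [||e3 E3 r3] := hd (e1, e2) _ (drop (d * i) v).
- by apply/allpairsP; exists (e1, e2).
- by rewrite size_drop sv mulnS; lia.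
exists e3 => //; apply: restriction_cat r3.
have -> : word_act (take (2 ^ i) g ++ drop (2 ^ i) g) =
  word_act (drop (2 ^ i) g) \o word_act (take (2 ^ i) g).
  by apply/funext => w; rewrite word_act_cat.
exact: hu.
Qed.

Lemma level0_words : exists (E : seq transformation) (d : nat),
  forall i g w, below 1 g -> size g <= 2 ^ i ->
    exists2 e, e \in E &
      shift (#|A| + d * i) (word_act g w) = e (shift (#|A| + d * i) w).
Proof.
have [E [d hE]] := contracting_words; exists E, d => i g w bg sg.
have gB : all (fun a => a.1 \in B) (word_res g w #|A|).
  elim: g w bg {sg} => //= a g ih w /andP[la /ih ->]; rewrite andbT.
  by apply: letter_res_sub => //; apply/eqP; rewrite -leqn0.
have [||e eE [u [su hu]]] := hE i _ (mkseq (shift #|A| w) (d * i)) gB.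
- by rewrite size_word_res.
- by rewrite size_mkseq.
exists e => //; rewrite -!shiftD -word_act_shift.
rewrite -{1}(wcat_mkseq (d * i) (shift #|A| w)) hu.
by rewrite -{1}(size_mkseq (shift #|A| w) (d * i)) -su shift_wcat.
Qed.

(** Both bounds are proved together, since each uses separation at the level below. Contraction
    makes the lowest level linear in [i.+1], and the [i] halving rounds of every further level raise
    the degree by one. *)
Lemma level_bound j : exists K, forall i n, n <= 2 ^ i ->
  separates j.+1 n (K * i.+1 ^ j.+1) /\
  forall w, covered (word_ball j.+1 n w) (#|X| ^ (K * i.+1 ^ j.+1)).
Proof.
have X0 : 0 < #|X| by exact: ltnW.
elim: j => [|j [K ih]].
  have [E [d hE]] := level0_words.
  (* Finitely many maps and pairs of special sequences are involved, so one depth [d'] detects every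
     inequality [e q <> p]. *)
  have [||d' hd'] := @seq_bound _ (fun (e : transformation) n =>
    forall p q, p \in special -> q \in special -> agree n (e q) p -> e q = p) E.
  - by move=> e m n mn h p q sp sq ag; apply: h => //; apply: agree_le ag.
  - move=> e _.
    have [||n hn] := @seq_bound _ (fun (pq : (nat -> X) * (nat -> X)) n =>
      agree n (e pq.2) pq.1 -> e pq.2 = pq.1) [seq (p, q) | p <- special, q <- special].
    + by move=> pq m n mn h ag; apply: h; apply: agree_le ag.
    + move=> [p q] _ /=; have [eq|ne] := pselect (e q = p); first by exists 0.
      apply: contrapT => h; apply: ne; apply: agree_all => n.
      by apply: contrapT => nag; apply: h; exists n => /nag.
    exists n => p q sp sq; apply: (hn (p, q)).
    by apply/allpairsP; exists (p, q).
  (* The last summand pays for the choice of [e], as [size E] is at most [#|X| ^ size E]. *)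
  exists (#|A| + d + d' + size E) => i n ni.
  have le : #|A| + d * i + d' + size E <= (#|A| + d + d' + size E) * i.+1 ^ 1.
    by rewrite expn1; nia.
  split.
    move=> g p q bg sg sq sp ag; have [e eE he] := hE i g q bg (leq_trans sg ni).
    apply: (@agree_shift_eq _ (#|A| + d * i)); first by apply: agree_le ag; lia.
    rewrite he; apply: (hd' e eE); try exact: special_shift.
    rewrite -he; apply: agree_shift; apply: agree_le ag; lia.
  move=> w; apply: (@covered_le _ _ (#|X| ^ (#|A| + d * i) * size E)).
    apply: leq_trans (leq_pexp2l X0 le).
    rewrite !expnD -!mulnA leq_mul2l leq_mul2l; apply/orP; right.
    apply/orP; right; apply: leq_trans (leq_pmull _ _); last by rewrite expn_gt0 X0.
    exact/ltnW/ltn_expl.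
  pose F := [set u | [set` [seq e (shift (#|A| + d * i) w) | e <- E]]
    (shift (#|A| + d * i) u)].
  apply: (@covered_sub _ _ F); last first.
    apply: covered_shift; rewrite -(size_map (@^~ (shift (#|A| + d * i) w))).
    exact: covered_seq.
  move=> _ [g [bg sg <-]]; have [e eE he] := hE i g w bg (leq_trans sg ni).
  by rewrite /F /= he map_f.
(* With [F = #|X| ^ f], the second factor in [word_ball_succ] is at most [F ^ 3 * c], and [c] is at
   most [#|X| ^ c]. *)
pose c := 2 * size special ^ 2 * #|X| + 1.
exists (#|A| + c + 4 * K) => i n ni; have [sep cov] := ih i n ni.
set f := K * i.+1 ^ j.+1 in sep cov.
have le : #|A| + i * f + c + 3 * f <= (#|A| + c + 4 * K) * i.+1 ^ j.+2.
  have : 0 < i.+1 ^ j.+1 by rewrite expn_gt0.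
  rewrite /f [i.+1 ^ j.+2]expnS; move: (i.+1 ^ j.+1) => t t0.
  have h1 : K * t <= K * (i.+1 * t) by rewrite leq_mul2l leq_pmull ?orbT.
  have h2 : #|A| + c <= (#|A| + c) * (i.+1 * t) by rewrite leq_pmulr // muln_gt0.
  have h3 : i * (K * t) + K * t = K * (i.+1 * t) by ring.
  by rewrite mulnDl -mulnA; lia.
split.
  apply: separates_le (separates_succ hB hcycles _ ni sep) => //.
  by apply: leq_trans le; lia.
move=> w; apply: covered_le (word_ball_succ w _ ni sep cov) => //.
apply: leq_trans (leq_pexp2l X0 le).
rewrite -addnA; move: (#|A| + i * f) => D; rewrite expnD leq_mul2l.
apply/orP; right.
have F0 : 0 < #|X| ^ f by rewrite expn_gt0 X0.
have -> : #|X| ^ (c + 3 * f) = (#|X| ^ f) ^ 3 * #|X| ^ c.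
  by rewrite expnD mulnC [3 * f]mulnC expnM.
move: (#|X| ^ f) F0 => F F0.
apply: (@leq_trans (F ^ 3 * c)); last first.
  by apply: leq_mul => //; exact/ltnW/ltn_expl.
rewrite /c mulnDr muln1 addnC leq_add //; last by rewrite -{1}(expn1 F) leq_pexp2l.
move: (size special) (#|X|) X0 => a x xgt0.
have xF : (x * F).+1 <= 2 * (x * F) by have : 0 < x * F; [rewrite muln_gt0 xgt0|lia].
apply: (@leq_trans (F * (a * (a * (2 * (x * F))) * F))).
  by rewrite leq_mul2l leq_mul2r leq_mul2l leq_mul2l xF !orbT.
by apply: eq_leq; ring.
Qed.

End Growth.

(** * Growth of the Schreier graphs *)

Section Logarithms.
Local Open Scope nat_scope.

(** This is the value of [i.+1] in [level_bound] for the least [i] with [n <= 2 ^ i]. *)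
Definition logn2 n := (up_log 2 n).+1.

(** For positive [d], [k.+1] is at most [d * 2 ^ (k %/ d)]; raising to the power [d] gives at most
    [d ^ d * 2 ^ k], and [2 ^ k <= 2 * n] for [k = up_log 2 n]. *)
Lemma logn2_poly d n : 0 < n -> logn2 n ^ d <= d ^ d * (2 * n).
Proof.
move=> n0; apply: (@leq_trans (d ^ d * 2 ^ up_log 2 n)); last first.
  rewrite leq_mul2l; apply/orP; right.
  have [|n1] := leqP n 1; first by case: n n0 => [|[]] // _ _; rewrite up_log1.
  have := up_log_bounds (isT : 1 < 2) n1 => /andP[+ _].
  have := up_log_gt0 2 n; rewrite n1; case: (up_log 2 n) => // k _ /= lt.
  by rewrite expnS leq_mul2l ltnW.
rewrite /logn2; move: (up_log 2 n) => k.
case: d => [|d]; first by rewrite !expn0 mul1n expn_gt0.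
have h1 : k.+1 <= d.+1 * (k %/ d.+1).+1.
  by rewrite mulnC ltn_ceil.
apply: (@leq_trans ((d.+1 * 2 ^ (k %/ d.+1)) ^ d.+1)).
  rewrite leq_exp2r //; apply: leq_trans h1 _.
  by rewrite leq_mul2l ltn_expl.
by rewrite expnMn -expnM leq_mul2l leq_exp2l // leq_divM orbT.
Qed.

(** Rounding up and the successor add at most two, and [log2] is at least one. *)
Lemma logn2_log2 (R : realType) n : ((logn2 n)%:R <= 3 * log2 R n :> R)%R.
Proof.
rewrite /log2 /logn2; case: leqP => [|n1].
  by case: n => [|[]] // _; rewrite ?up_log0 ?up_log1; lra.
have l2 : (0 < ln 2 :> R)%R by rewrite ln_gt0 // ltr1n.
have n0 : 0 < n by exact: ltnW.
have := up_log_bounds (isT : 1 < 2) n1 => /andP[+ _].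
have := up_log_gt0 2 n; rewrite n1; case: (up_log 2 n) => // k _ /= lt.
have h1 : (1 <= ln n%:R / ln 2 :> R)%R.
  rewrite ler_pdivlMr // mul1r ler_ln ?posrE ?ltr0n //.
  by rewrite (ler_nat R 2 n).
have h2 : (k%:R <= ln n%:R / ln 2 :> R)%R.
  rewrite ler_pdivlMr // mulr_natl -lnXn ?ltr0n // ler_ln ?posrE ?exprn_gt0 ?ltr0n //.
  by rewrite -natrX ler_nat ltnW.
by rewrite -addn2 natrD; lra.
Qed.

(** Bernoulli's inequality. *)
Lemma expr_unbounded (R : realType) (a M : R) : (1 < a -> exists k, M <= a ^+ k)%R.
Proof.
move=> a1; have b k : (1 + k%:R * (a - 1) <= a ^+ k)%R.
  elim: k => [|k ih]; first by rewrite mul0r addr0 expr0.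
  rewrite exprS; apply: (@le_trans _ _ (a * (1 + k%:R * (a - 1)))%R).
    rewrite -natr1; have : (0 <= k%:R * (a - 1) ^+ 2 :> R)%R.
      by rewrite mulr_ge0 // sqr_ge0.
    by nra.
  by rewrite ler_wpM2l //; lra.
exists (Num.truncn (`|M| / (a - 1))).+1; apply: le_trans (b _).
have a0 : (0 < a - 1)%R by lra.
have : (`|M| / (a - 1) < (Num.truncn (`|M| / (a - 1))).+1%:R)%R by exact: truncnS_gt.
rewrite ltr_pdivrMr // => h; have := ler_norm M.
by move=> h'; apply: le_trans h' _; apply: le_trans (ltW h) _; rewrite lerDr.
Qed.

End Logarithms.

(** * From balls in Schreier graphs to words in the states *)

Section SchreierGraphs.
Variables (X : finType) (A : automaton X).
Local Open Scope nat_scope.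
Local Notation G := (automaton_group [set: A]%SET).

Lemma generators_words (S : set ((nat -> X) -> (nat -> X))) :
  finite_set S -> S `<=` G ->
  exists2 e, 0 < e & forall s, with_inverses S s ->
    exists2 g : seq (A * bool), size g <= e & s = word_act g.
Proof.
move=> /finite_seqP[Ss eS] SG.
have [||e he] := @seq_bound _ (fun (s : (nat -> X) -> (nat -> X)) n =>
    exists2 g : seq (A * bool), size g <= n & s = word_act g) Ss.
- by move=> s m n mn [g sg ->]; exists g => //; apply: leq_trans mn.
- move=> s sS; have [|g _ ->] := @automaton_group_word _ A [set: A]%SET s.
    by apply: SG; rewrite eS.
  by exists (size g), g.
(* The successor only ensures positivity; inverses have the same length. *)
exists e.+1 => // s [|[f]]; rewrite eS => /he[g sg ->].
  by exists g => //; apply: leqW.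
move=> [fK Kf]; exists (word_inv g).
  by rewrite size_rev size_map leqW.
by apply/funext => w; rewrite -{2}(Kf w) word_actK.
Qed.

Lemma graph_ball_words (S : set ((nat -> X) -> (nat -> X))) (B : {set A}) e w v n :
  (forall s, with_inverses S s ->
    exists2 g : seq (A * bool), size g <= e & s = word_act g) ->
  graph_ball (schreier_graph G S w) v n `<=`
    word_ball B (max_connected_cycles B).+1 (e * n) v.
Proof.
move=> hS; have bl g : below B (max_connected_cycles B).+1 g.
  by apply/allP => a _; rewrite ltnS level_max.
elim: n => [|n ih] u /=; first by move=> ->; exists [::].
case=> [/ih[g [_ sg <-]]|[_ [t /ih[g [_ sg <-]] [s /hS[h sh ->] <-]]]].
  by exists g; split=> //; apply: leq_trans sg _; rewrite leq_mul2l leqnSn orbT.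
exists (g ++ h); rewrite word_act_cat size_cat; split=> //.
by rewrite mulnS addnC leq_add.
Qed.

End SchreierGraphs.

Theorem theorem5 (R : realType) (X : finType) (A : automaton X) (B : {set A})
    (hX : (1 < #|X|)%N)
    (hmin : minimized A)
    (hB : subautomaton B)
    (hcycles : disjoint_cycles B)
    (hcontr : contracting (automaton_group B)) :
  exists C : R,
    forall S : set ((nat -> X) -> (nat -> X)),
      finite_set S -> generated_group S = automaton_group [set: A]%SET ->
    forall w : nat -> X,
      let Gamma := schreier_graph (automaton_group [set: A]%SET) S w in
      forall v : nat -> X, vertices Gamma v ->
        let gamma := fun n : nat => (growth Gamma v n)%:R : R in
        subexponential gamma /\
        growth_le gamma (fun n : nat =>
          #|X|%:R `^ (C * log2 R n ^+ (max_connected_cycles B).+1)).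
Proof.
have /card_gt0P[x0 _] : (0 < #|X|)%N by exact: ltnW.
set d := (max_connected_cycles B).+1.
have [K hK] := level_bound x0 hX hB hcycles hcontr (max_connected_cycles B).
rewrite -/d in hK.
(* The factor [3 ^ d] comes from replacing [logn2] by [log2] under the power [d]. *)
exists (K * 3 ^ d)%:R => S fS eS w Gamma v vG gamma.
have [e e0 he] : exists2 e, (0 < e)%N & forall s, with_inverses S s ->
    exists2 g : seq (A * bool), (size g <= e)%N & s = word_act g.
  by apply: generators_words => // s Ss; rewrite -eS; apply: generated_gen.
have bound n : (growth Gamma v n <= #|X| ^ (K * logn2 (e * n) ^ d))%N.
  apply: covered_card.
  apply: covered_sub (@graph_ball_words _ _ S B e w v n he) _.
  by apply: (hK _ _ _).2; apply: up_logP.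
have X1 : 1 < #|X|%:R :> R by rewrite ltr1n.
split; last first.
  (* The length [e] of the generators only rescales the radius, so [C] does not depend on [S]. *)
  exists e => // n; apply: (@le_trans _ _ (#|X| ^ (K * logn2 (e * n) ^ d))%:R).
    by rewrite ler_nat.
  rewrite natrX -(powR_mulrn _ (ler0n R #|X|)).
  apply: (ler_powR (ltW X1)).
  rewrite !natrM !natrX -mulrA ler_wpM2l ?ler0n // -exprMn.
  apply: lerXn2r (logn2_log2 _ _); rewrite ?nnegrE //.
  exact: le_trans (logn2_log2 _ _).
(* The exponent [k] converts the bound to base [a]. *)
move=> a a1; have [k hk] := expr_unbounded (#|X|%:R ^+ K) a1.
have bound' n : gamma n <= a ^+ (k * logn2 (e * n) ^ d).
  apply: (@le_trans _ _ (#|X| ^ (K * logn2 (e * n) ^ d))%:R).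
    by rewrite ler_nat.
  rewrite natrX !exprM; apply: lerXn2r => //; rewrite nnegrE exprn_ge0 //.
  exact/ltW/(lt_trans ltr01).
split.
  exists (k * (d ^ d * 2 * e)).+1 => // n.
  (* At radius 0 the right-hand side is 1 for every constant, so the one-point ball is counted
     directly. *)
  case: n => [|n].
    rewrite muln0 expr0 /gamma (ler_nat R _ 1).
    exact/covered_card/covered1.
  apply: le_trans (bound' _) _; rewrite ler_eXn2l //.
  have := @logn2_poly d (e * n.+1); rewrite muln_gt0 e0 => /(_ isT) h.
  rewrite mulSn; apply: leq_trans (leq_addl _ _).
  by rewrite -!mulnA leq_mul2l h orbT.
(* Squaring the logarithmic bound makes it linear in n. *)
move=> [_ [c c0 hc]].
pose b := ((2 * d) ^ (2 * d) * (2 * (e * c)))%N.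
(* Large enough to contradict [n * n <= k * k * b * n]. *)
pose n := (k * k * b).+1.
have h1 : (n <= k * logn2 (e * (c * n)) ^ d)%N.
  by rewrite -(ler_eXn2l a1); apply: le_trans (hc n) (bound' _).
have h2 : ((logn2 (e * (c * n)) ^ d) ^ 2 <= b * n)%N.
  rewrite -expnM [(d * 2)%N]mulnC; apply: leq_trans (logn2_poly _ _) _.
    by rewrite !muln_gt0 e0 c0.
  by rewrite /b !mulnA.
have : (n * n <= k * k * b * n)%N.
  rewrite -mulnA; apply: leq_trans (leq_mul (leqnn (k * k)) h2).
  by apply: leq_trans (leq_mul h1 h1) _; rewrite expnS expn1 mulnACA.
by rewrite leq_mul2r ltnn.
Qed.
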